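(* For every positive integer $n$, the limit $\lambda_n = \lim_{k\to\infty} F(n,k)^{1/k}$ exists and satisfies $\lambda_n \leq 2$.
   Context: A column is an infinite vertical stack of cells (with a bottom cell, and unbounded upward), and a board is a finite sequence of columns (so the columns are distinguishable). A position on a board is a placement of finitely many tokens in cells such that each token is either red or yellow, no two tokens occupy the same cell, and the occupied cells in each column form a contiguous block starting from the bottom. Equivalently, a position on an $n$-column board is an $n$-tuple of finite words over $\{R,Y\}$, each column being read from bottom to top. A reachable position is one that can be obtained from the empty board by a finite sequence of moves, where each move inserts a token into the lowest empty cell of some column, and the inserted tokens alternate globally between red and yellow from move to move, the first move placing a red token. There is no win condition. $F(n,k)$ denotes the number of positions on an $n$-column board that are reachable in exactly $k$ moves. *)

(* Defs.v *)
From HB Require Import structures.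
From mathcomp Require Import all_boot all_order all_algebra finmap.
From mathcomp Require Import all_classical all_reals all_analysis.

Set Implicit Arguments.
Unset Strict Implicit.
Unset Printing Implicit Defensive.

Local Open Scope classical_set_scope.

Inductive token := Red | Yellow.

Definition bool_of_token (t : token) : bool := if t is Red then true else false.
Definition token_of_bool (b : bool) : token := if b then Red else Yellow.

Lemma bool_of_tokenK : cancel bool_of_token token_of_bool.
Proof. by case. Qed.

HB.instance Definition _ := Finite.copy token (can_type bool_of_tokenK).

(* Each column is the word of its tokens, read from bottom to top. *)
Definition position (n : nat) := {ffun 'I_n -> seq token}.

Definition empty_position (n : nat) : position n := [ffun=> [::]].

(* The lowest empty cell of column i is the one just above the last letter of
   the word p i. *)
Definition insert_token (n : nat) (p : position n) (i : 'I_n) (t : token) :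
    position n :=
  [ffun j => if j == i then rcons (p j) t else p j].

(* The token played after k moves have already been made; Red starts. *)
Definition next_token (k : nat) : token := if odd k then Yellow else Red.

Inductive reachable (n : nat) : nat -> position n -> Prop :=
| reachable_empty : reachable 0 (empty_position n)
| reachable_move (k : nat) (p : position n) (i : 'I_n) :
    reachable k p -> reachable k.+1 (insert_token p i (next_token k)).

Lemma finite_reachable (n k : nat) :
  finite_set [set p : position n | reachable k p].
Proof.
elim: k => [|k IHk].
  apply: (@sub_finite_set _ _ [set empty_position n]); last exact: finite_set1.
  by move=> p /= Hp; inversion Hp.
pose f (q : position n * 'I_n) := insert_token q.1 q.2 (next_token k).
apply: (@sub_finite_set _ _
  (f @` ([set p : position n | reachable k p] `*` [set: 'I_n]))).
  by move=> p /= Hp; inversion Hp as [|k' q i Hq]; subst; exists (q, i).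
exact/finite_image/finite_setX.
Qed.

(* fset_set is meaningful here by finite_reachable. *)
Definition F (n k : nat) : nat :=
  #|` fset_set [set p : position n | reachable k p]|%fset.

(* Main.v *)
(** Stacking a position reachable in l moves, with colours exchanged if k is
    odd, on top of one reachable in k moves gives a position reachable in k + l
    moves, and the pair is recovered from the result and the k-move column
    heights.  Hence F(k) F(l) <= (k+1)^n F(k+l), and a version of Fekete's lemma
    with a sublinear error term gives the limit.  A position is determined by
    its heights and the concatenation of its columns, so F(k) <= (k+1)^n 2^k,
    which bounds the limit by 2. *)

Require Import Defs.
From HB Require Import structures.
From mathcomp Require Import all_boot all_order all_algebra.
From mathcomp Require Import all_classical all_reals all_analysis.
From mathcomp Require Import finmap lra.

Set Implicit Arguments.
Unset Strict Implicit.
Unset Printing Implicit Defensive.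

Import Order.TTheory GRing.Theory Num.Theory.
Import numFieldNormedType.Exports.

Local Open Scope classical_set_scope.
Local Open Scope ring_scope.

(** * Stacking of reachable positions *)

Section Positions.

Variable n : nat.

Implicit Types (p q : position n) (k l : nat).

Definition stack p q : position n := [ffun i => p i ++ q i].

Definition recolor (b : bool) (t : token) : token :=
  token_of_bool (b (+) bool_of_token t).

Definition recolor_position (b : bool) p : position n :=
  [ffun i => map (recolor b) (p i)].

Lemma recolorK b : involutive (recolor b).
Proof. by case: b; case. Qed.

Lemma recolor_positionK b : involutive (recolor_position b).
Proof.
move=> p; apply/ffunP => i; rewrite !ffunE -map_comp map_id_in // => t _.
exact: recolorK.
Qed.

Lemma next_tokenD k l :
  next_token (k + l) = recolor (odd k) (next_token l).
Proof. by rewrite /next_token oddD; case: (odd k); case: (odd l). Qed.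

Lemma recolor_insert_token b q i t :
  recolor_position b (insert_token q i t)
  = insert_token (recolor_position b q) i (recolor b t).
Proof. by apply/ffunP => j; rewrite !ffunE; case: eqP => // _; rewrite map_rcons. Qed.

Lemma stack_insert_token p q i t :
  stack p (insert_token q i t) = insert_token (stack p q) i t.
Proof. by apply/ffunP => j; rewrite !ffunE; case: eqP => // _; rewrite rcons_cat. Qed.

(** The moves of [q] are replayed after those of [p]. Each comes [k] moves later, so its colour
    changes exactly when [k] is odd. *)
Lemma reachable_stack k l p q : reachable k p -> reachable l q ->
  reachable (k + l) (stack p (recolor_position (odd k) q)).
Proof.
move=> kp; elim=> [|l' q' i _ IH].
  rewrite addn0 (_ : stack _ _ = p) //.
  by apply/ffunP => i; rewrite !ffunE cats0.
rewrite addnS recolor_insert_token stack_insert_token -next_tokenD.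
exact: reachable_move.
Qed.

Lemma size_reachable k p : reachable k p -> (\sum_i size (p i) = k)%N.
Proof.
elim=> [|k' q i _ IH]; first by rewrite big1 // => i _; rewrite ffunE.
rewrite -IH (bigD1 i) //= [in RHS](bigD1 i) //= ffunE eqxx size_rcons addSn.
by congr (_ + _).+1; apply: eq_bigr => j /negPf ji; rewrite ffunE ji.
Qed.

Lemma leq_size_reachable k p i : reachable k p -> (size (p i) <= k)%N.
Proof. by move=> /size_reachable <-; rewrite (bigD1 i) //= leq_addr. Qed.

Lemma exists_reachable k : (0 < n)%N -> exists p, reachable k p.
Proof.
move=> n_gt0; elim: k => [|k [p kp]]; first by exists (empty_position n); constructor.
by exists (insert_token p (Ordinal n_gt0) (next_token k)); constructor.
Qed.

(** * Counting reachable positions *)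

Definition positions k : seq (position n) :=
  enum_fset (fset_set [set p : position n | reachable k p]).

Lemma positionsP k p : reflect (reachable k p) (p \in positions k).
Proof.
rewrite /positions -[_ \in _]/(p \in fset_set _).
rewrite in_fset_set; last exact: finite_reachable.
by apply: (iffP idP) => [/set_mem|kp]; last exact/mem_set.
Qed.

Lemma positions_uniq k : uniq (positions k).
Proof. exact: fset_uniq. Qed.

Lemma F_size k : F n k = size (positions k).
Proof. by []. Qed.

Lemma F_gt0 k : (0 < n)%N -> (0 < F n k)%N.
Proof.
move=> /(exists_reachable k)[p /positionsP]; rewrite F_size.
by case: (positions k).
Qed.

(** No column exceeds height [k] after [k] moves, so [inord] loses nothing there, and this finite
    type has exactly [k.+1 ^ n] elements. *)
Definition heights k p : {ffun 'I_n -> 'I_k.+1} := [ffun i => inord (size (p i))].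

Lemma heights_inj k p q : reachable k p -> reachable k q ->
  heights k p = heights k q -> forall i, size (p i) = size (q i).
Proof.
move=> kp kq /ffunP eh i; have := congr1 val (eh i).
by rewrite !ffunE /= !inordK // ltnS leq_size_reachable.
Qed.

(* Recoloring [q] when [k] is odd restores the global alternation; the heights
   of [p] tell where [q] starts in each column of the stacked position. *)
Lemma F_supermul k l : (F n k * F n l <= F n (k + l) * k.+1 ^ n)%N.
Proof.
(* Reading the factor as a number of height profiles reduces the claim to an injection between two
   lists of pairs. *)
have <- : #|{ffun 'I_n -> 'I_k.+1}| = (k.+1 ^ n)%N by rewrite card_ffun !card_ord.
rewrite !F_size cardE.
rewrite -!(size_allpairs pair).
pose f (u : position n * position n) :=
  (stack u.1 (recolor_position (odd k) u.2), heights k u.1).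
rewrite -(size_map f); apply: uniq_leq_size.
  rewrite map_inj_in_uniq.
    by apply: allpairs_uniq; rewrite ?positions_uniq // => -[? ?] [? ?].
  move=> u v /allpairsP[[p q] /= [/positionsP kp /positionsP lq ->]].
  move=> /allpairsP[[p' q'] /= [/positionsP kp' /positionsP lq' ->]].
  case=> /ffunP eS eh.
  have es := heights_inj kp kp' eh.
  have pqE i : p i = p' i /\
      recolor_position (odd k) q i = recolor_position (odd k) q' i.
    (* The lower words have equal sizes, so equal concatenations split at the same place. *)
    have := eS i; rewrite !ffunE => /eqP.
    by rewrite eqseq_cat // => /andP[/eqP -> /eqP ->].
  congr (_, _); first by apply/ffunP => i; have [] := pqE i.
  apply: (can_inj (recolor_positionK (odd k))).
  by apply/ffunP => i; have [] := pqE i.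
move=> _ /mapP[_ /allpairsP[[p q] /= [/positionsP kp /positionsP lq ->]] ->].
apply: allpairs_f; last by rewrite mem_enum.
exact/positionsP/reachable_stack.
Qed.

Lemma card_token : #|{: token}| = 2%N.
Proof.
rewrite -card_bool; apply: (bij_eq_card (f := bool_of_token)).
by exists token_of_bool; case.
Qed.

Definition letters p : seq token := flatten [seq p i | i <- enum 'I_n].

Lemma size_letters k p : reachable k p -> size (letters p) = k.
Proof.
move=> /size_reachable <-.
by rewrite size_flatten /shape -map_comp sumnE big_map big_enum.
Qed.

Lemma F_le k : (F n k <= k.+1 ^ n * 2 ^ k)%N.
Proof.
(* For a position reachable in [k] moves, [letters p] has length [k], so the default [Red] is never
   read. *)
pose f p := (heights k p, [ffun j : 'I_k => nth Red (letters p) j]).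
have f_inj : {in positions k &, injective f}.
  move=> p q /positionsP kp /positionsP kq [eh /ffunP el].
  have es := heights_inj kp kq eh.
  have eL : letters p = letters q.
    apply: (@eq_from_nth _ Red); first by rewrite !(@size_letters k).
    rewrite (size_letters kp) => i ik.
    by have := el (Ordinal ik); rewrite !ffunE.
  have eM : [seq p i | i <- enum 'I_n] = [seq q i | i <- enum 'I_n].
    (* The common heights cut the common word back into columns. *)
    rewrite -[LHS]flattenK -[RHS]flattenK -!/(letters _) eL; congr reshape.
    by rewrite /shape -!map_comp; apply: eq_map => i /=.
  by apply/ffunP => i; move/eq_in_map: eM; apply; rewrite mem_enum.
rewrite F_size -(size_map f).
have /card_uniqP <- : uniq (map f (positions k)).
  by rewrite map_inj_in_uniq // positions_uniq.
apply: leq_trans (max_card _) _.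
by rewrite card_prod !card_ffun !card_ord card_token.
Qed.

End Positions.

(** * Growth rates of almost superadditive sequences *)

Section Limits.

Variable R : realType.

Lemma cvg_ln_div_nat (c : R) : c * ln k.+1%:R / k%:R @[k --> \oo] --> (0 : R).
Proof.
rewrite (_ : (fun k => _) = (fun k => c * (ln k.+1%:R / k%:R))); last first.
  by apply/funext => k; rewrite mulrA.
rewrite -[X in _ --> X](mulr0 c); apply: cvgMr; apply/cvgrPdist_le => e e0.
near=> k.
have k0 : 0 < k%:R :> R by near: k; exact: nbhs_infty_gtr.
rewrite sub0r normrN ger0_norm; last by rewrite divr_ge0 ?ln_ge0 ?ler1n.
rewrite ler_pdivrMr // -[leRHS]expRK ler_ln ?posrE ?expR_gt0 ?ltr0n //.
have ek0 : 0 <= e * k%:R by rewrite mulr_ge0 ?ltW.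
(* Since exp x >= 1 + x^2 / 2, taking x = e k leaves only k >= 2 / e^2 to ensure. *)
apply: le_trans (expR_ge1Dxn 1 ek0).
rewrite -natr1 addrC lerD2l ler_pdivlMr // (_ : 2`! = 2)%N //.
have : 2 / (e * e) <= k%:R by near: k; exact: nbhs_infty_ger.
rewrite ler_pdivrMr ?mulr_gt0 // -(ler_pM2r k0); lra.
Unshelve. all: by end_near. Qed.

(* Iterating the hypothesis [m %/ k] times along [m = m %/ k * k + m %% k]
   bounds [a m / m] below by about [(a k - e k) / k], so [a k / k] tends to the
   supremum of the [(a k - e k) / k]. *)
Lemma fekete (a e : nat -> R) (C : R) :
    (forall k, 0 <= a k) -> (forall k l, a k + a l <= a (k + l)%N + e k) ->
    (forall k, a k <= k%:R * C + e k) -> e k / k%:R @[k --> \oo] --> (0 : R) ->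
  exists2 S : R, S <= C & a k / k%:R @[k --> \oo] --> S.
Proof.
move=> a0 aD aC e0.
pose E : set R := [set (a k - e k) / k%:R | k in [set k | (0 < k)%N]].
have EC : ubound E C.
  move=> _ [k /= k0 <-]; rewrite ler_pdivrMr ?ltr0n //.
  by have := aC k; lra.
have supE : has_sup E by split; [exists ((a 1%N - e 1%N) / 1%:R); exists 1%N|exists C].
exists (sup E); first by apply: ge_sup => //; case: supE.
(* Keeping [r] inside the argument makes the base case just [0 <= a r]. *)
have iter k q r : q%:R * (a k - e k) <= a (q * k + r)%N.
  elim: q => [|q IH]; first by rewrite mul0r.
  by rewrite mulSn -addnA -natr1 mulrDl mul1r; have := aD k (q * k + r)%N; lra.
apply/cvgrPdist_le => eps eps0.
have [|_ [k /= k0 <-] hk] := @sup_adherent _ E (eps / 2) _ supE; first by lra.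
set c := a k - e k in hk.
near=> m.
have m0 : 0 < m%:R :> R by near: m; exact: nbhs_infty_gtr.
have kR0 : 0 < k%:R :> R by rewrite ltr0n.
rewrite ler_distlC; apply/andP; split.
  (* Replacing m / k by its integer part costs at most |c| / m after division by m, hence eps / 2
     for large m. The other eps / 2 comes from the choice of [k]. *)
  have cm : `|c| / (eps / 2) <= m%:R by near: m; exact: nbhs_infty_ger.
  have {}cm : `|c| / m%:R <= eps / 2.
    by move: cm; rewrite !ler_pdivrMr //; lra.
  have mE : m%:R = (m %/ k)%:R * k%:R + (m %% k)%:R :> R.
    by rewrite -natrM -natrD -divn_eq.
  have rk : (m %% k)%:R <= k%:R :> R by rewrite ler_nat ltnW // ltn_mod.
  have : c / k%:R - `|c| / m%:R <= a m / m%:R.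
    rewrite ler_pdivlMr // mulrBl divfK ?gt_eqF //.
    apply: le_trans (_ : (m %/ k)%:R * c <= _); last first.
      by have := iter k (m %/ k)%N (m %% k)%N; rewrite -divn_eq.
    have -> : c / k%:R * m%:R = (m %/ k)%:R * c + c * ((m %% k)%:R / k%:R).
      by rewrite mE mulrDr mulrCA divfK ?gt_eqF // mulrA mulrAC.
    rewrite -addrA gerDl subr_le0; apply: le_trans (ler_norm _) _.
    rewrite normrM ler_piMr // ger0_norm ?divr_ge0 // ler_pdivrMr //.
    by rewrite mul1r.
  by lra.
(* For the upper bound, (a m - e m) / m lies in [E], so a m / m exceeds the supremum by at most e m
   / m. *)
have em : e m / m%:R <= eps.
  near: m; move/cvgrPdist_le : e0 => /(_ _ eps0); apply: filterS => m.
  by rewrite sub0r normrN; exact: le_trans (ler_norm _).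
have : (a m - e m) / m%:R <= sup E.
  apply: ub_le_sup; first by case: supE.
  by exists m => //=; rewrite -(ltr0n R).
by rewrite mulrBl; lra.
Unshelve. all: by end_near. Qed.

End Limits.

Theorem theorem7 (R : realType) (n : nat) (hn : (0 < n)%N) :
  exists lambda : R,
    (((F n k)%:R : R) `^ (k%:R)^-1) @[k --> \oo] --> lambda /\ lambda <= 2.
Proof.
have F0 k : 0 < (F n k)%:R :> R by rewrite ltr0n F_gt0.
have lnX k m : ln (k.+1 ^ m)%:R = m%:R * ln k.+1%:R :> R.
  by rewrite natrX lnXn ?ltr0n // mulr_natl.
(* Under the logarithm, the polynomial factor (k + 1)^n of both counting bounds becomes the
   sublinear error. *)
have [] := @fekete R (fun k => ln (F n k)%:R) (fun k => n%:R * ln k.+1%:R) (ln 2).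
- by move=> k; rewrite ln_ge0 // ler1n F_gt0.
- move=> k l; rewrite -lnX -!lnM ?posrE ?ltr0n ?muln_gt0 ?expn_gt0 ?F_gt0 //.
  rewrite -!natrM ler_ln ?posrE ?ltr0n ?muln_gt0 ?expn_gt0 ?F_gt0 //.
  by rewrite ler_nat F_supermul.
- move=> k; rewrite -!lnX -lnM ?posrE ?ltr0n ?expn_gt0 //.
  rewrite -natrM ler_ln ?posrE ?ltr0n ?muln_gt0 ?expn_gt0 ?F_gt0 //.
  by rewrite ler_nat mulnC F_le.
- exact: cvg_ln_div_nat.
move=> S S2 aS; exists (expR S); split.
  rewrite (_ : (fun k => _) = expR \o (fun k => ln (F n k)%:R / k%:R)).
    by apply: cvg_comp aS _; exact: continuous_expR.
  by apply/funext => k; rewrite /powR gt_eqF //= mulrC.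
by rewrite -[leRHS](@lnK R) ?posrE // ler_expR.
Qed.
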